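(* Suppose that: (i) for each $(\pi,V)\in\mathbb{S}\times\mathbb{R}^d$ there exists a unique Nash minimizer $P(\pi,V)$ of $e(\pi,\cdot,V)$; (ii) each cost $c_{ij}(\pi,P)=c_{ij}(\pi,P_{i\cdot})$ depends only on $\pi$ and on the $i$-th row $P_{i\cdot}$ of $P$; (iii) there exists a constant $\gamma>0$ such that $$\tilde\pi\cdot(\mathcal{G}_{\tilde\pi}(V)-\mathcal{G}_\pi(V))+\pi\cdot(\mathcal{G}_\pi(\tilde V)-\mathcal{G}_{\tilde\pi}(\tilde V))\ge\gamma\|\pi-\tilde\pi\|^2$$ for any $V,\tilde V\in\mathbb{R}^d$ and all $\pi,\tilde\pi\in\mathbb{S}$. Let $N\ge1$ and let $\{(\pi^n,V^n): 0\le n\le N\}$ and $\{(\tilde\pi^n,\tilde V^n): 0\le n\le N\}$ be solutions of the mean field game with $\pi^0=\tilde\pi^0$ and $V^N=\tilde V^N$. Then $\pi^n=\tilde\pi^n$ and $V^n=\tilde V^n$ for all $0\le n\le N$.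
   Context: Let $d>1$ be an integer and $\mathbb{S}=\{(q_1,\dots,q_d): q_j\ge 0\ \forall j,\ \sum_{j=1}^d q_j=1\}$. The set of $d\times d$ (row-)stochastic (transition) matrices is identified with $\mathbb{S}^d$. Given transition costs $c_{ij}(\pi,P)$, $1\le i,j\le d$ (functions of $\pi\in\mathbb{S}$, $P\in\mathbb{S}^d$), define $e_i(\pi,P,V)=\sum_j \left(c_{ij}(\pi,P)P_{ij}+V_jP_{ij}\right)$ for $V\in\mathbb{R}^d$. For $P\in\mathbb{S}^d$, $q\in\mathbb{S}$, $\mathcal{P}(P,q,i)$ is the stochastic matrix obtained from $P$ by replacing its $i$-th row by $q$. A matrix $P\in\mathbb{S}^d$ is a Nash minimizer of $e(\pi,\cdot,V)$ if for each $i$ and any $q\in\mathbb{S}$, $e_i(\pi,P,V)\le e_i(\pi,\mathcal{P}(P,q,i),V)$. When a unique Nash minimizer $P(\pi,V)$ exists for all $(\pi,V)$, define $\mathcal{G}_\pi(V)_i=e_i(\pi,P(\pi,V),V)$ and $\mathcal{K}_V(\pi)=\pi P(\pi,V)$ (row vector times matrix). A sequence $\{(\pi^n,V^n): 0\le n\le N\}$ in $\mathbb{S}\times\mathbb{R}^d$ is a solution of the mean field game if $V^n=\mathcal{G}_{\pi^n}(V^{n+1})$ and $\pi^{n+1}=\mathcal{K}_{V^{n+1}}(\pi^n)$ for every $0\le n\le N-1$. $\|\cdot\|$ is a fixed norm on $\mathbb{R}^d$. *)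

(* Defs.v *)
From mathcomp Require Import all_boot all_order all_algebra.
From mathcomp Require Import boolp classical_sets reals.
Set Implicit Arguments.
Unset Strict Implicit.
Unset Printing Implicit Defensive.
Import Order.TTheory GRing.Theory Num.Theory.
Local Open Scope classical_set_scope.
Local Open Scope ring_scope.

Definition simplex (R : realType) (d : nat) : set 'rV[R]_d :=
  [set q | (forall j, 0 <= q 0 j) /\ \sum_j q 0 j = 1].

Definition stochastic (R : realType) (d : nat) : set 'M[R]_d :=
  [set P | forall i, simplex (row i P)].

(* [c i j pi P] is the cost of the transition from i to j.  The function is
   total, but only its values at pi in the simplex and P stochastic matter. *)
Definition costs (R : realType) (d : nat) : Type :=
  'I_d -> 'I_d -> 'rV[R]_d -> 'M[R]_d -> R.

Definition dotv (R : realType) (d : nat) (u v : 'rV[R]_d) : R :=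
  \sum_j u 0 j * v 0 j.

Definition is_norm (R : realType) (d : nat) (nrm : 'rV[R]_d -> R) : Prop :=
  [/\ forall x y, nrm (x + y) <= nrm x + nrm y,
      forall a x, nrm (a *: x) = `|a| * nrm x
    & forall x, nrm x = 0 -> x = 0].

Definition expected_cost (R : realType) (d : nat) (c : costs R d)
    (i : 'I_d) (pi : 'rV[R]_d) (P : 'M[R]_d) (V : 'rV[R]_d) : R :=
  \sum_j (c i j pi P * P i j + V 0 j * P i j).

Definition replace_row (R : realType) (d : nat)
    (P : 'M[R]_d) (q : 'rV[R]_d) (i : 'I_d) : 'M[R]_d :=
  \matrix_(k, j) (if k == i then q 0 j else P k j).

Definition nash_minimizer (R : realType) (d : nat) (c : costs R d)
    (pi V : 'rV[R]_d) : set 'M[R]_d :=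
  [set P | stochastic P /\
    forall (i : 'I_d) (q : 'rV[R]_d), simplex q ->
      expected_cost c i pi P V <= expected_cost c i pi (replace_row P q i) V].

(* P(pi, V): a Nash minimizer picked by choice, with the junk value 0 when
   there is none; it is the Nash minimizer whenever that one is unique. *)
Definition nash (R : realType) (d : nat) (c : costs R d)
    (pi V : 'rV[R]_d) : 'M[R]_d :=
  xget 0 (nash_minimizer c pi V).

Definition Gop (R : realType) (d : nat) (c : costs R d)
    (pi V : 'rV[R]_d) : 'rV[R]_d :=
  \row_i expected_cost c i pi (nash c pi V) V.

Definition Kop (R : realType) (d : nat) (c : costs R d)
    (V pi : 'rV[R]_d) : 'rV[R]_d :=
  pi *m nash c pi V.

(* Only the terms of index 0 <= n <= N are constrained. *)
Definition mfg_solution (R : realType) (d : nat) (c : costs R d) (N : nat)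
    (pi V : nat -> 'rV[R]_d) : Prop :=
  (forall n, (n <= N)%N -> simplex (pi n)) /\
  (forall n, (n < N)%N ->
     V n = Gop c (pi n) (V n.+1) /\ pi n.+1 = Kop c (V n.+1) (pi n)).

(* Main.v *)
(** The proof is the discrete duality argument of Lasry and Lions.  Each
    coordinate of [G_pi] lies below the affine function of [V] obtained by
    freezing the Nash minimizer, so [P(pi, V)] is a supergradient of [G_pi] at
    [V].  Combined with the monotonicity hypothesis this shows that
    [(pi^n - pi'^n) . (V^n - V'^n)] decreases by at least
    [gamma |pi^n - pi'^n|^2] from n to n+1; as it vanishes at n = 0 and n = N,
    the distributions agree, and then so do the values, by backward
    recursion. *)
Require Import Defs.
From mathcomp Require Import all_boot all_order all_algebra.
From mathcomp Require Import boolp classical_sets reals.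
From mathcomp Require Import lra.
Set Implicit Arguments.
Unset Strict Implicit.
Unset Printing Implicit Defensive.
Import Order.TTheory GRing.Theory Num.Theory.
Local Open Scope ring_scope.

Lemma dotvBr (R : realType) (d : nat) (u v w : 'rV[R]_d) :
  dotv u (v - w) = dotv u v - dotv u w.
Proof.
by rewrite /dotv -sumrB; apply: eq_bigr => j _; rewrite !mxE mulrBr.
Qed.

Lemma dotvBl (R : realType) (d : nat) (u v w : 'rV[R]_d) :
  dotv (u - v) w = dotv u w - dotv v w.
Proof.
by rewrite /dotv -sumrB; apply: eq_bigr => j _; rewrite !mxE mulrBl.
Qed.

Lemma dotv0r (R : realType) (d : nat) (u : 'rV[R]_d) : dotv u 0 = 0.
Proof. by rewrite /dotv big1 // => j _; rewrite mxE mulr0. Qed.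

Lemma dotv0l (R : realType) (d : nat) (u : 'rV[R]_d) : dotv 0 u = 0.
Proof. by rewrite /dotv big1 // => j _; rewrite mxE mul0r. Qed.

(** Duality between the forward and backward equations: transporting [p] by [P] amounts to averaging
    [w] by [P^T]. *)
Lemma dotv_mulmx (R : realType) (d : nat) (p w : 'rV[R]_d) (P : 'M[R]_d) :
  dotv (p *m P) w = dotv p (w *m P^T).
Proof.
rewrite /dotv; under eq_bigr do rewrite mxE mulr_suml.
rewrite exchange_big; apply: eq_bigr => i _; rewrite mxE mulr_sumr.
by apply: eq_bigr => j _; rewrite mxE -mulrA [P i j * _]mulrC.
Qed.

Lemma ler_dotv (R : realType) (d : nat) (p u v : 'rV[R]_d) : simplex p ->
  (forall i, u 0 i <= v 0 i) -> dotv p u <= dotv p v.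
Proof. by move=> [p_ge0 _] uv; apply: ler_sum => j _; rewrite ler_wpM2l. Qed.

Lemma row_replace_row (R : realType) (d : nat) (P : 'M[R]_d) (q : 'rV[R]_d)
  (i k : 'I_d) : row k (replace_row P q i) = if k == i then q else row k P.
Proof. by apply/rowP => j; rewrite !mxE; case: eqP => // _; rewrite mxE. Qed.

Lemma stochastic_replace_row (R : realType) (d : nat) (P : 'M[R]_d)
  (q : 'rV[R]_d) (i : 'I_d) :
  stochastic P -> simplex q -> stochastic (replace_row P q i).
Proof. by move=> sP sq k; rewrite row_replace_row; case: eqP. Qed.

Section NashMinimizers.
Variables (R : realType) (d : nat) (c : costs R d).
Hypothesis nash_ex : forall pi V : 'rV[R]_d, simplex pi ->
  exists P : 'M[R]_d, nash_minimizer c pi V P.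
Hypothesis cost_row : forall (i j : 'I_d) (pi : 'rV[R]_d) (P Q : 'M[R]_d),
  simplex pi -> stochastic P -> stochastic Q ->
  row i P = row i Q -> c i j pi P = c i j pi Q.

Lemma nashP (pi V : 'rV[R]_d) : simplex pi ->
  nash_minimizer c pi V (nash c pi V).
Proof. by move=> spi; have [P hP] := nash_ex V spi; apply: xgetPex; exists P. Qed.

(** This is where the row dependence of the costs enters; the minimizers at two different values may
    differ in every row. *)
Lemma eq_expected_cost (i : 'I_d) (pi V : 'rV[R]_d) (P Q : 'M[R]_d) :
  simplex pi -> stochastic P -> stochastic Q -> row i P = row i Q ->
  expected_cost c i pi P V = expected_cost c i pi Q V.
Proof.
move=> spi sP sQ PQ; apply: eq_bigr => j _.
rewrite (cost_row j spi sP sQ PQ).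
by move/rowP/(_ j): PQ; rewrite !mxE => ->.
Qed.

Lemma expected_cost_shift (i : 'I_d) (pi V W : 'rV[R]_d) (P : 'M[R]_d) :
  expected_cost c i pi P W =
  expected_cost c i pi P V + ((W - V) *m P^T) 0 i.
Proof.
rewrite /expected_cost mxE -big_split /=; apply: eq_bigr => j _.
by rewrite !mxE; lra.
Qed.

Lemma Gop_supergradient (pi V W : 'rV[R]_d) (i : 'I_d) : simplex pi ->
  Gop c pi W 0 i <= (Gop c pi V + (W - V) *m (nash c pi V)^T) 0 i.
Proof.
move=> spi; have [sP _] := nashP V spi; have [sQ minQ] := nashP W spi.
rewrite mxE [leRHS]mxE [X in _ <= X + _]mxE -expected_cost_shift.
(* The minimizer at [W] is tested against the deviation of [i] to its row in the minimizer at [V];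
   the other rows are then exchanged for those of the latter. *)
apply: le_trans (minQ i _ (sP i)) _.
rewrite (@eq_expected_cost i pi W _ (nash c pi V)) //.
  exact: stochastic_replace_row.
by rewrite row_replace_row eqxx.
Qed.

(** Average of the supergradient inequality with the nonnegative weights [pi]. *)
Lemma dotv_Kop_le (pi V W : 'rV[R]_d) : simplex pi ->
  dotv (Kop c V pi) (V - W) <= dotv pi (Gop c pi V - Gop c pi W).
Proof.
move=> spi; rewrite /Kop dotv_mulmx; apply: ler_dotv => // i.
have := Gop_supergradient V W i spi.
by rewrite -opprB mulNmx !mxE; lra.
Qed.

(** Add [dotv_Kop_le] for [pi] and for [pi'], with [V] and [V'] exchanged: the right-hand side of
    the conclusion exceeds the sum of the two bounds by exactly the expression that [b] bounds from
    below. *)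
Lemma duality_step (pi pi' V V' : 'rV[R]_d) (b : R) :
  simplex pi -> simplex pi' ->
  b <= dotv pi' (Gop c pi' V - Gop c pi V)
       + dotv pi (Gop c pi V' - Gop c pi' V') ->
  dotv (Kop c V pi - Kop c V' pi') (V - V') + b <=
  dotv (pi - pi') (Gop c pi V - Gop c pi' V').
Proof.
move=> spi spi'.
have := dotv_Kop_le V V' spi; have := dotv_Kop_le V' V spi'.
by rewrite !(dotvBl, dotvBr); lra.
Qed.

End NashMinimizers.

Theorem theorem6 (R : realType) (d : nat) (d_gt1 : (1 < d)%N)
    (c : costs R d) (nrm : 'rV[R]_d -> R) (nrm_norm : is_norm nrm)
    (nash_unique : forall pi V : 'rV[R]_d, simplex pi ->
       exists! P : 'M[R]_d, nash_minimizer c pi V P)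
    (cost_row : forall (i j : 'I_d) (pi : 'rV[R]_d) (P Q : 'M[R]_d),
       simplex pi -> stochastic P -> stochastic Q ->
       row i P = row i Q -> c i j pi P = c i j pi Q)
    (monotone : exists2 gamma : R, 0 < gamma &
       forall V V' pi pi' : 'rV[R]_d, simplex pi -> simplex pi' ->
         dotv pi' (Gop c pi' V - Gop c pi V)
           + dotv pi (Gop c pi V' - Gop c pi' V')
         >= gamma * nrm (pi - pi') ^+ 2)
    (N : nat) (N_ge1 : (1 <= N)%N)
    (pi V pi' V' : nat -> 'rV[R]_d)
    (sol : mfg_solution c N pi V) (sol' : mfg_solution c N pi' V')
    (init : pi 0%N = pi' 0%N) (final : V N = V' N) :
  forall n : nat, (n <= N)%N -> pi n = pi' n /\ V n = V' n.
Proof.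
have [gamma gamma_gt0 mono] := monotone.
have [spi recV] := sol; have [spi' recV'] := sol'.
have nash_ex (p U : 'rV[R]_d) (sp : simplex p) :
    exists P, nash_minimizer c p U P.
  by have [P [hP _]] := nash_unique p U sp; exists P.
pose a n := dotv (pi n - pi' n) (V n - V' n).
have step n : (n < N)%N ->
    a n.+1 + gamma * nrm (pi n - pi' n) ^+ 2 <= a n.
  move=> nN; have [eV eK] := recV n nN; have [eV' eK'] := recV' n nN.
  rewrite /a eK eK' [V n]eV [V' n]eV'.
  have sp := spi n (ltnW nN); have sp' := spi' n (ltnW nN).
  exact: duality_step nash_ex cost_row _ _ _ _ _ sp sp' (mono _ _ _ _ sp sp').
have gap_ge0 n : 0 <= gamma * nrm (pi n - pi' n) ^+ 2.
  by rewrite mulr_ge0 ?sqr_ge0 ?ltW.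
have a_le0 n : (n <= N)%N -> a n <= 0.
  elim: n => [|n IHn] nN; first by rewrite /a init subrr dotv0l.
  by have := step n nN; have := IHn (ltnW nN); have := gap_ge0 n; lra.
(* Here [k] counts the steps back from the common final value. *)
have a_ge0 k : (k <= N)%N -> 0 <= a (N - k)%N.
  elim: k => [|k IHk] kN; first by rewrite subn0 /a final subrr dotv0r.
  have lt_N : (N - k.+1 < N)%N by rewrite -subn_gt0 subKn.
  have := step _ lt_N; rewrite subnSK //.
  by have := IHk (ltnW kN); have := gap_ge0 (N - k.+1)%N; lra.
(* The case [n = N] is left out, since [step] needs a successor. For [n < N], the signs
   [a n <= 0 <= a n.+1] force the gap to vanish. *)
have eq_pi n : (n < N)%N -> pi n = pi' n.
  move=> nN; have [_ _ nrm_eq0] := nrm_norm.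
  apply/eqP; rewrite -subr_eq0; apply/eqP/nrm_eq0/eqP.
  have a_n1 := a_ge0 (N - n.+1)%N (leq_subr _ _); rewrite subKn // in a_n1.
  have gap_le0 : gamma * nrm (pi n - pi' n) ^+ 2 <= 0.
    by have := step n nN; have := a_le0 n (ltnW nN); lra.
  by move: gap_le0; rewrite pmulr_rle0 // real_exprn_even_le0 ?num_real.
(* The backward equation at [n < N] involves only [pi n] and [V n.+1], on which the two solutions
   already agree. *)
have eq_V k : (k <= N)%N -> V (N - k)%N = V' (N - k)%N.
  elim: k => [|k IHk] kN; first by rewrite subn0.
  have lt_N : (N - k.+1 < N)%N by rewrite -subn_gt0 subKn.
  have [-> _] := recV _ lt_N; have [-> _] := recV' _ lt_N.
  by rewrite eq_pi // subnSK // IHk // ltnW.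
move=> n nN; split; last by rewrite -(subKn nN) eq_V ?leq_subr.
have [/eq_pi //|Nn] := ltnP n N.
(* The last distribution comes from one forward step out of [N.-1], which exists because
   [N >= 1]. *)
have -> : n = N by apply/eqP; rewrite eqn_leq nN.
have lt_N : (N.-1 < N)%N by rewrite prednK.
have [_ eK] := recV _ lt_N; have [_ eK'] := recV' _ lt_N.
by rewrite -(prednK N_ge1) eK eK' prednK // final eq_pi.
Qed.
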